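(* (Geometric duality theorem.) The map $\Psi$ is an inclusion reversing (i.e. $F_1^*\subseteq F_2^*\Leftrightarrow\Psi(F_1^* )\supseteq\Psi(F_2^* )$) one-to-one map between the set of all $R^*$-maximal proper faces of $\mathcal{D}$ and the set of all $R$-minimal proper faces of $\mathcal{P}$ (i.e. a bijection from the former set onto the latter). The inverse map is $$\Psi^{-1}(F)=\bigcap_{y\in F}\{w\in\mathcal{D} : \varphi(y,w)=0\}.$$ Moreover, if $F^*$ is an $R^*$-maximal proper face of $\mathcal{D}$, then $\dim F^*+\dim\Psi(F^* )=q-1$.
   Context: Data: positive integers $n,m,q$; matrices $A\in\mathbb{R}^{m\times n}$, $P\in\mathbb{R}^{q\times n}$; $b\in\mathbb{R}^m$; a polyhedral convex cone $C\subseteq\mathbb{R}^q$ that is pointed ($C\cap -C=\{0\}$) and non-trivial ($C\neq\{0\}$). The set $S:=\{x\in\mathbb{R}^n : Ax\ge b\}$ is assumed nonempty. The upper image is $\mathcal{P}:=P[S]+C\subseteq\mathbb{R}^q$, where $P[S]=\{Px : x\in S\}$. Polar cone: $C^\circ:=\{w : w^Ty\le 0\ \forall y\in C\}$. Fix $c\in\operatorname{ri}C\times\{0\}\subseteq\mathbb{R}^{q+1}$ with $c_q=1$, and write $p(c)=(c_1,\dots,c_q)^T\in\operatorname{ri}C$. Let $R:=\operatorname{cone}\{p(c)\}=\{\lambda p(c) : \lambda\ge0\}$ and $R^*:=\{v\in\mathbb{R}^q : v_1=\dots=v_{q-1}=0,\ v_q\ge 0\}$. Let $T:=\{(u,w)\in\mathbb{R}^m\times\mathbb{R}^q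 : A^Tu=P^Tw,\ p(c)^Tw=1,\ w\in -C^\circ,\ u\ge 0\}$, $D(u,w):=(w_1,\dots,w_{q-1},b^Tu)^T$, and let the lower image be $\mathcal{D}:=D[T]-R^*\subseteq\mathbb{R}^q$. Define $\varphi:\mathbb{R}^q\times\mathbb{R}^q\to\mathbb{R}$ by $\varphi(y,w):=\sum_{i=1}^{q-1}y_iw_i+y_q\bigl(1-\sum_{i=1}^{q-1}c_iw_i\bigr)-w_q$, and $\Psi(F^* ):=\bigcap_{w\in F^*}\{y\in\mathcal{P} : \varphi(y,w)=0\}$. A convex subset $F$ of a convex set $B$ is a face of $B$ if $y,z\in B$, $\lambda\in(0,1)$, $\lambda y+(1-\lambda)z\in F$ imply $y,z\in F$; it is proper if $\emptyset\ne F\ne B$. For a pointed convex cone $Q$, a point $y$ is $Q$-minimal in $B$ if $y\in B$ and $y\notin B+(Q\setminus\{0\})$, and $Q$-maximal in $B$ if it is $(-Q)$-minimal in $B$. A face $F$ of $\mathcal{P}$ is $R$-minimal if all its points are $R$-minimal in $\mathcal{P}$; a face $F^*$ of $\mathcal{D}$ is $R^*$-maximal if all its points are $R^*$-maximal in $\mathcal{D}$. $\dim$ of a convex set is the dimension of its affine hull. *)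

(* Defs.v *)
From mathcomp Require Import all_boot all_order all_algebra.
From mathcomp Require Import all_classical all_reals all_analysis.

Set Implicit Arguments.
Unset Strict Implicit.
Unset Printing Implicit Defensive.

Import Order.TTheory GRing.Theory Num.Theory.
Import numFieldNormedType.Exports.

Local Open Scope classical_set_scope.
Local Open Scope ring_scope.

(* The ambient dimensions are written k.+1 where they must be positive; the
   last coordinate of a vector of 'cV[R]_q.+1 has index ord_max. *)

Section Convexity.
Variables (R : realType) (k : nat).
Notation V := ('cV[R]_k).
Implicit Types (A B C F Q M : set V) (x y z w : V).

Definition dotp x y : R := (x^T *m y) 0 0.

Definition msum A B : set V := [set x + y | x in A & y in B].

Definition mopp A : set V := [set - x | x in A].

Definition polyhedron A : Prop :=
  exists (r : nat) (Z : 'M[R]_(r, k)) (z : 'cV[R]_r),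
    A = [set y | forall i, z i 0 <= (Z *m y) i 0].

Definition is_cone C : Prop :=
  C !=set0 /\ forall (l : R) y, 0 <= l -> C y -> C (l *: y).

Definition polyhedral_convex_cone C : Prop :=
  [/\ polyhedron C, convex_set C & is_cone C].

Definition pointed_cone C : Prop := C `&` mopp C = [set 0].

Definition polar C : set V := [set w | forall y, C y -> dotp w y <= 0].

Definition ray y : set V := [set l *: y | l in [set l : R | 0 <= l]].

Definition affine_set M : Prop :=
  forall x y (l : R), M x -> M y -> M ((1 - l) *: x + l *: y).

Definition affine_hull A : set V := smallest affine_set A.

Definition relint A : set V :=
  [set x | A x /\ \forall y \near x, affine_hull A y -> A y].

(* Dimension of the linear subspace parallel to the affine hull.  That subspace
   exists and is unique when A is nonempty; on the empty set the value is 0. *)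
Definition affdim A : nat :=
  \dim (xget 0%VS [set U : {vspace V} |
    exists2 a, affine_hull A a & affine_hull A = [set a + u | u in [set` U]]]).

Definition face F B : Prop :=
  [/\ convex_set F, F `<=` B &
      forall y z (l : R), B y -> B z -> 0 < l -> l < 1 ->
        F (l *: y + (1 - l) *: z) -> F y /\ F z].

Definition proper_face F B : Prop := [/\ face F B, F !=set0 & F <> B].

Definition minimal_pts Q B : set V :=
  [set y | B y /\ ~ msum B (Q `\ 0) y].

Definition maximal_pts Q B : set V := minimal_pts (mopp Q) B.

Definition minimal_proper_faces Q B : set (set V) :=
  [set F | proper_face F B /\ F `<=` minimal_pts Q B].

Definition maximal_proper_faces Q B : set (set V) :=
  [set F | proper_face F B /\ F `<=` maximal_pts Q B].

End Convexity.

Section GeometricDuality.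
Variables (R : realType) (n m q : nat).
Variables (A : 'M[R]_(m, n)) (P : 'M[R]_(q.+1, n)) (b : 'cV[R]_m).
Variables (C : set 'cV[R]_q.+1) (c : 'cV[R]_(q.+1 + 1)).

(* p(c): all coordinates of c but the last one, which is required to be 0. *)
Definition pvec : 'cV[R]_q.+1 := usubmx c.

Definition feasible : set 'cV[R]_n :=
  [set x | forall i, b i 0 <= (A *m x) i 0].

Definition upper_image : set 'cV[R]_q.+1 :=
  msum [set P *m x | x in feasible] C.

Definition dual_feasible : set ('cV[R]_m * 'cV[R]_q.+1) :=
  [set uw | [/\ A^T *m uw.1 = P^T *m uw.2,
                dotp pvec uw.2 = 1,
                mopp (polar C) uw.2 &
                forall i, 0 <= uw.1 i 0]].

Definition dual_obj (uw : 'cV[R]_m * 'cV[R]_q.+1) : 'cV[R]_q.+1 :=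
  \col_i (if i == ord_max then dotp b uw.1 else uw.2 i 0).

Definition Rstar : set 'cV[R]_q.+1 :=
  [set v | (forall i, i != ord_max -> v i 0 = 0) /\ 0 <= v ord_max 0].

Definition lower_image : set 'cV[R]_q.+1 :=
  msum [set dual_obj uw | uw in dual_feasible] (mopp Rstar).

(* The points w here are those of the lower image: their last coordinate is an
   objective value, while the dual vector has last coordinate
   1 - \sum_(i | i != ord_max) c_i w_i, forced by p(c)^T w = 1 and
   p(c) ord_max 0 = 1. *)
Definition phi (y w : 'cV[R]_q.+1) : R :=
  \sum_(i | i != ord_max) y i 0 * w i 0
  + y ord_max 0 * (1 - \sum_(i | i != ord_max) pvec i 0 * w i 0)
  - w ord_max 0.

Definition Psi (Fs : set 'cV[R]_q.+1) : set 'cV[R]_q.+1 :=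
  \bigcap_(w in Fs) [set y | upper_image y /\ phi y w = 0].

Definition Psi_inv (F : set 'cV[R]_q.+1) : set 'cV[R]_q.+1 :=
  \bigcap_(y in F) [set w | lower_image w /\ phi y w = 0].

End GeometricDuality.

(* Main.v *)
Require Import Defs.
From mathcomp Require Import all_boot all_order all_algebra.
From mathcomp Require Import all_classical all_reals all_analysis.
From mathcomp Require Import ring lra.

Set Implicit Arguments.
Unset Strict Implicit.
Unset Printing Implicit Defensive.

Import Order.TTheory GRing.Theory Num.Theory.
Import numFieldNormedType.Exports.

Local Open Scope classical_set_scope.
Local Open Scope ring_scope.

(** Write [lift w] for the dual vector encoded by a point [w] of the lower image
    (the last coordinate of [w] is replaced so that the product with [p = p(c)]
    is 1). Then [phi y w] is [lift w . y] minus the last coordinate of [w]; it is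
    affine in each argument, and the proof studies the polarity it defines.

    Linear programming duality (the affine Farkas lemma [farkas]) says that the
    lower image D is the set of all [w] with [0 <= phi y w] for every [y] in the
    upper image P ([lower_imageP]). Hence the common zeros in one image of
    points of the other one form a face; if nonempty, it is proper and its
    points are minimal, respectively maximal, since [phi] is strictly monotone
    along [p] and along the last axis ([Psi_minimal_face],
    [Psi_inv_maximal_face]).

    Conversely P and D are both polyhedra: P is a linear projection of one, and
    D is the trace of the cone of the inequalities valid on P, which is again
    finitely constrained; both facts, as well as Farkas' lemma, come from
    Fourier-Motzkin elimination ([fm], [dual_cone_hrep]). A nonempty face of a
    polyhedron is the set where the constraints active at one of its points are
    active ([face_active]), hence the zero set of their sum. Minimality means
    that some active constraint involves [p] (the last axis for D), so that this
    sum can be normalized to a function [phi _ w] with [w] in D, respectively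
    [phi y _] with [y] in P. Thus the faces considered are exposed by one point
    of the other image ([minimal_face_exposed], [maximal_face_exposed]), which
    makes [Psi] and [Psi_inv] inverse to each other; both reverse inclusions by
    definition.

    For the dimensions, let B be the matrix of the active constraints of a
    minimal face F of P. The directions of F form the kernel of B, and those of
    the conjugate face are parametrized by the vectors of the row space of B
    orthogonal to [p]. As [B p] is not 0, the dimensions are [q + 1 - rank B]
    and [rank B - 1], where [q + 1] is the dimension of the ambient space
    ([affdim_Psi_inv]). *)

(** * The scalar product *)

Section DotProduct.
Variables (R : realType) (k : nat).
Implicit Types x y z : 'cV[R]_k.

Lemma dotpE x y : dotp x y = \sum_i x i 0 * y i 0.
Proof. by rewrite /dotp !mxE; apply: eq_bigr => i _; rewrite mxE. Qed.

Lemma dotpC x y : dotp x y = dotp y x.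
Proof. by rewrite !dotpE; apply: eq_bigr => i _; rewrite mulrC. Qed.

Lemma dotpDr x y z : dotp x (y + z) = dotp x y + dotp x z.
Proof. by rewrite /dotp mulmxDr mxE. Qed.

Lemma dotpZr (a : R) x y : dotp x (a *: y) = a * dotp x y.
Proof. by rewrite /dotp -scalemxAr mxE. Qed.

Lemma dotpNr x y : dotp x (- y) = - dotp x y.
Proof. by rewrite /dotp mulmxN mxE. Qed.

Lemma dotp0r x : dotp x 0 = 0.
Proof. by rewrite /dotp mulmx0 mxE. Qed.

Lemma dotpDl x y z : dotp (x + y) z = dotp x z + dotp y z.
Proof. by rewrite dotpC dotpDr !(dotpC z). Qed.

Lemma dotpZl (a : R) x y : dotp (a *: x) y = a * dotp x y.
Proof. by rewrite dotpC dotpZr dotpC. Qed.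

Lemma dotpNl x y : dotp (- x) y = - dotp x y.
Proof. by rewrite dotpC dotpNr dotpC. Qed.

Lemma dotp0l x : dotp 0 x = 0.
Proof. by rewrite dotpC dotp0r. Qed.

Lemma dotp_suml (I : Type) (r : seq I) (p : pred I) (f : I -> 'cV[R]_k) y :
  dotp (\sum_(i <- r | p i) f i) y = \sum_(i <- r | p i) dotp (f i) y.
Proof.
elim/big_rec2 : _ => [|i u v _ IH]; first by rewrite dotp0l.
by rewrite dotpDl IH.
Qed.

Lemma dotp_delta i x : dotp (delta_mx i 0) x = x i 0.
Proof.
rewrite dotpE (bigD1 i) //= mxE !eqxx mul1r big1 ?addr0 // => j /negbTE ji.
by rewrite mxE ji mul0r.
Qed.

Lemma dotp_row r (M : 'M[R]_(r, k)) i x : dotp (row i M)^T x = (M *m x) i 0.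
Proof. by rewrite dotpE mxE; apply: eq_bigr => j _; rewrite !mxE. Qed.

Lemma dotp_trmul r (M : 'M[R]_(r, k)) (u : 'cV_r) x :
  dotp (M^T *m u) x = dotp u (M *m x).
Proof. by rewrite /dotp trmx_mul trmxK mulmxA. Qed.

Lemma ler_dotp (u x y : 'cV[R]_k) : (forall i, 0 <= u i 0) ->
  (forall i, x i 0 <= y i 0) -> dotp u x <= dotp u y.
Proof.
by move=> u0 xy; rewrite !dotpE ler_sum // => i _; rewrite ler_wpM2l.
Qed.

End DotProduct.

(** * Fourier-Motzkin elimination and linear programming duality *)

Section Elimination.
Variable R : realType.

(** Elimination of one unknown [x]: every lower bound on [x] is compared with
    every upper bound. The coefficients live in a module [V] that is paired
    linearly with the parameters. *)
Lemma fm1 (V : lmodType R) (T : Type) (ev : V -> T -> R)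
    (ev_lin : forall a u v y, ev (a *: u + v) y = a * ev u y + ev v y)
    (I : finType) (al : I -> R) (v : I -> V) :
  exists (J : finType) (g : J -> V), forall y,
    (exists x, forall i, 0 <= al i * x + ev (v i) y) <->
    (forall j, 0 <= ev (g j) y).
Proof.
exists ({i | al i == 0} + {i | 0 < al i} * {i | al i < 0})%type.
exists (fun t => match t with
  | inl i => v (val i)
  | inr (i, j) => al (val i) *: v (val j) + (- al (val j)) *: v (val i) end).
have evD a b u w y : ev (a *: u + b *: w) y = a * ev u y + b * ev w y.
  have ev0 : ev 0 y = 0.
    by have := ev_lin (-1) u u y; rewrite scaleN1r addNr => ->; ring.
  by rewrite ev_lin -[b *: w]addr0 ev_lin ev0 addr0.
move=> y; split=> [[x xP] [[i /= /eqP i0]|[[i /= i0] [j /= j0]]]|H].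
- by have := xP i; rewrite i0 mul0r add0r.
- by rewrite evD; have := xP i; have := xP j; nra.
have H0 i : al i = 0 -> 0 <= ev (v i) y.
  by move=> /eqP i0; exact: (H (inl (exist _ i i0))).
have Hpn i j : 0 < al i -> al j < 0 ->
    - ev (v i) y / al i <= - ev (v j) y / al j.
  move=> i0 j0; have := H (inr (exist _ i i0, exist _ j j0)); rewrite /= evD.
  move=> h; rewrite ler_pdivrMr // mulrAC ler_ndivlMr //; lra.
suff [x [xp xn]] : exists x, (forall i, 0 < al i -> - ev (v i) y / al i <= x)
    /\ (forall j, al j < 0 -> x <= - ev (v j) y / al j).
  exists x => i; case: (ltgtP (al i) 0) => i0.
  - by have := xn _ i0; rewrite ler_ndivlMr //; lra.
  - by have := xp _ i0; rewrite ler_pdivrMr //; lra.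
  - by rewrite i0 mul0r add0r H0.
have [i0 i0P|nop] := pickP [pred i | 0 < al i].
  have [i iP imax] := arg_maxP (fun i => - ev (v i) y / al i) i0P.
  by exists (- ev (v i) y / al i); split=> [j jP|j jN]; [exact: imax|exact: Hpn].
have [j0 j0P|non] := pickP [pred i | al i < 0].
  have [j jP jmin] := arg_minP (fun i => - ev (v i) y / al i) j0P.
  exists (- ev (v j) y / al j); split=> [i iP|i iN]; last exact: jmin.
  by have := nop i; rewrite /= iP.
by exists 0; split=> i ii; [have := nop i|have := non i]; rewrite /= ii.
Qed.

(** Elimination of a vector of unknowns: the inequalities are affine in the
    eliminated [x] and, through a pairing [ev] that is linear in its first
    argument, depend on a parameter [y] of any kind. *)
Lemma fm (n : nat) (V : lmodType R) (T : Type) (ev : V -> T -> R)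
    (ev_lin : forall a u v y, ev (a *: u + v) y = a * ev u y + ev v y)
    (I : finType) (al : I -> 'cV[R]_n) (v : I -> V) :
  exists (J : finType) (g : J -> V), forall y,
    (exists x, forall i, 0 <= dotp (al i) x + ev (v i) y) <->
    (forall j, 0 <= ev (g j) y).
Proof.
elim: n V T ev ev_lin I al v => [|n IH] V T ev ev_lin I al v.
  exists I, v => y; split=> [[x xP] i|vP].
    by have := xP i; rewrite dotpE big_ord0 add0r.
  by exists 0 => i; rewrite dotpE big_ord0 add0r.
pose ev' (p : 'cV[R]_n * V) (q : 'cV[R]_n * T) := dotp p.1 q.1 + ev p.2 q.2.
have ev'_lin a u w y : ev' (a *: u + w) y = a * ev' u y + ev' w y.
  by rewrite /ev' /= dotpDl dotpZl ev_lin; ring.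
have dotpS (a x : 'cV[R]_n.+1) : dotp a x =
    a ord0 0 * x ord0 0 + dotp (dsubmx (a : 'cV_(1 + n))) (dsubmx (x : 'cV_(1 + n))).
  rewrite !dotpE big_ord_recl; congr (_ + _); apply: eq_bigr => i _.
  by rewrite !mxE; congr (a _ _ * x _ _); apply/val_inj.
have [J [g gP]] := fm1 ev'_lin (fun i => al i ord0 0)
   (fun i => (dsubmx (al i : 'cV_(1 + n)), v i)).
have [K [h hP]] := IH V T ev ev_lin J (fun j => (g j).1) (fun j => (g j).2).
exists K, h => y; rewrite -hP; split=> [[x xP]|[x xP]].
  exists (dsubmx (x : 'cV_(1 + n))); apply/(gP (_, y)).
  by exists (x ord0 0) => i; rewrite /ev' /= addrA -dotpS.
have [x0 x0P] := (gP (x, y)).2 xP.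
exists (col_mx (x0%:M : 'cV_1) x) => i.
have := x0P i; rewrite /ev' /= addrA dotpS /=.
have -> : (dsubmx (col_mx (x0%:M : 'cV_1) x)) = x by rewrite col_mxKd.
suff -> : (col_mx (x0%:M : 'cV_1) x) ord0 0 = x0 by [].
have -> : ord0 = lshift n (ord0 : 'I_1) by apply/val_inj.
by rewrite col_mxEu mxE eqxx.
Qed.

(** The pairing of a homogenized inequality [0 <= a . y + s * t] with a
    homogenized point [(y, t)]. *)
Definition hpair k (p q : 'cV[R]_k * R^o) : R := dotp p.1 q.1 + p.2 * q.2.

Lemma hpair_lin k a u v (y : 'cV[R]_k * R^o) :
  hpair (a *: u + v) y = a * hpair u y + hpair v y.
Proof. by rewrite /hpair /= dotpDl dotpZl /GRing.scale /=; ring. Qed.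

(** The cone of the inequalities [t <= w . y] obtained from [z <= Z *m y] by
    nonnegative combination and weakening is itself given by finitely many
    inequalities, with coefficients [(a j, s j)]. If [s j = 0] then [a j] is a
    recession direction of the polyhedron; if [s j < 0] then [a j / - s j] is
    one of its points. *)
Lemma dual_cone_hrep r k (Z : 'M[R]_(r, k)) (z : 'cV[R]_r) :
  exists (J : finType) (a : J -> 'cV[R]_k) (s : J -> R),
    [/\ forall w t, (exists u : 'cV[R]_r, [/\ forall i, 0 <= u i 0,
            Z^T *m u = w & t <= dotp z u]) <->
          (forall j, 0 <= dotp (a j) w + s j * t),
        forall j, s j <= 0 &
        forall j i, 0 <= (Z *m a j) i 0 + s j * z i 0].
Proof.
pose I := ('I_r + 'I_k + 'I_k + unit)%type.
pose al (i : I) : 'cV[R]_r := match i with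
  | inl (inl (inl i)) => delta_mx i 0
  | inl (inl (inr j)) => col j Z
  | inl (inr j) => - col j Z
  | inr _ => z end.
pose v (i : I) : 'cV[R]_k * R^o := match i with
  | inl (inl (inl i)) => (0, 0)
  | inl (inl (inr j)) => (- delta_mx j 0, 0)
  | inl (inr j) => (delta_mx j 0, 0)
  | inr _ => (0, -1) end.
have [J [g gP]] := fm (@hpair_lin k) al v.
have dcol j u : dotp (col j Z) u = (Z^T *m u) j 0.
  by rewrite -dotp_row tr_row trmxK.
have key w t : (exists u : 'cV[R]_r, [/\ forall i, 0 <= u i 0,
      Z^T *m u = w & t <= dotp z u]) <->
    (forall j, 0 <= dotp (g j).1 w + (g j).2 * t).
  rewrite -(gP (w, t)); split=> [[u [u0 uw tu]]|[u uP]].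
    exists u => -[[[i|j]|j]|[]]; rewrite /hpair /= ?dotpNl ?dotp_delta ?dcol ?uw.
    - by rewrite dotp0l mul0r !addr0.
    - by rewrite mul0r addr0 subrr.
    - by rewrite mul0r addr0 addNr.
    - by rewrite dotp0l add0r mulN1r subr_ge0.
  exists u; split.
  - move=> i; have := uP (inl (inl (inl i))).
    by rewrite /hpair /= dotp_delta dotp0l mul0r !addr0.
  - apply/matrixP => j l; rewrite (ord1 l).
    have := uP (inl (inr j)); have := uP (inl (inl (inr j))).
    rewrite /hpair /= !dotpNl !dotp_delta dcol mul0r; lra.
  - by have := uP (inr tt); rewrite /hpair /= dotp0l; lra.
exists J, (fun j => (g j).1), (fun j => (g j).2); split=> // j.
  have /key/(_ j) : exists u : 'cV[R]_r, [/\ forall i, 0 <= u i 0,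
      Z^T *m u = 0 & -1 <= dotp z u].
    by exists 0; split=> [i||]; rewrite ?mxE ?mulmx0 ?dotp0r ?lerN10.
  by rewrite dotp0r; lra.
move=> i.
have /key/(_ j) : exists u : 'cV[R]_r, [/\ forall i, 0 <= u i 0,
      Z^T *m u = (row i Z)^T & z i 0 <= dotp z u].
  exists (delta_mx i 0); split=> [l||]; first by rewrite mxE ler0n.
  - apply/matrixP => l m; rewrite ord1 -dotp_row dotpC dotp_delta !mxE //.
  - by rewrite dotpC dotp_delta.
by rewrite dotpC dotp_row.
Qed.

(** Affine Farkas lemma: a linear inequality valid on a nonempty polyhedron is
    a nonnegative combination of the inequalities that define it. *)
Lemma farkas r k (Z : 'M[R]_(r, k)) (z : 'cV[R]_r)
    (y0 w : 'cV[R]_k) (t : R) :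
  (forall i, z i 0 <= (Z *m y0) i 0) ->
  (forall y : 'cV[R]_k, (forall i, z i 0 <= (Z *m y) i 0) -> t <= dotp w y) ->
  exists u : 'cV[R]_r, [/\ forall i, 0 <= u i 0, Z^T *m u = w & t <= dotp z u].
Proof.
move=> y0P wP; have [J [a [s [key s0 Zs]]]] := dual_cone_hrep Z z.
apply/key => j; case: (ltgtP (s j) 0) (s0 j) => // sj _.
  have /wP : forall i, z i 0 <= (Z *m ((- s j)^-1 *: a j)) i 0.
    move=> i; rewrite -scalemxAr mxE mulrC ler_pdivlMr ?oppr_gt0 //.
    by have := Zs j i; lra.
  by rewrite dotpZr mulrC ler_pdivlMr ?oppr_gt0 // dotpC; lra.
rewrite sj mul0r addr0 leNgt; apply/negP => aw.
(* a recession direction along which w decreases: go far enough to get below t *)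
pose l := (dotp w y0 - t + 1) / - dotp (a j) w.
have l0 : 0 <= l.
  by rewrite divr_ge0 // ?oppr_ge0 ?(ltW aw) //; have := wP _ y0P; lra.
have /wP : forall i, z i 0 <= (Z *m (y0 + l *: a j)) i 0.
  move=> i; rewrite mulmxDr -scalemxAr !mxE; have := Zs j i; have := y0P i.
  by rewrite sj mul0r addr0 !mxE; nra.
rewrite dotpDr dotpZr (dotpC w (a j)).
have -> : l * dotp (a j) w = - (dotp w y0 - t + 1).
  by rewrite /l; field; rewrite lt_eqF.
lra.
Qed.

(** The projection of a polyhedron along a linear parametrization. *)
Lemma polyhedron_proj r n k (M : 'M[R]_(r, n)) (N : 'M[R]_(r, k))
    (z : 'cV[R]_r) :
  polyhedron [set y | exists x : 'cV[R]_n,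
    forall i, z i 0 <= (M *m x + N *m y) i 0].
Proof.
have [J [g gP]] := fm (@hpair_lin k) (fun i : 'I_r => (row i M)^T)
   (fun i => ((row i N)^T, - z i 0)).
exists #|J|, (\matrix_(j, l) (g (enum_val j)).1 l 0).
exists (\col_j - (g (enum_val j)).2).
have E y j : ((\matrix_(j, l) (g (enum_val j)).1 l 0) *m y) j 0 =
    dotp (g (enum_val j)).1 y :> R.
  by rewrite mxE dotpE; apply: eq_bigr => l _; rewrite !mxE.
have F x y i : (0 <= dotp (row i M)^T x +
    @hpair k ((row i N)^T, - z i 0) (y, 1)) = (z i 0 <= (M *m x + N *m y) i 0).
  by rewrite /hpair /= !dotp_row mulr1 [in RHS]mxE -[RHS]subr_ge0 addrA.
apply/seteqP; split=> y.
  move=> [x xP] j; rewrite E !mxE.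
  have /gP/(_ (enum_val j)) : exists x, forall i, 0 <= dotp (row i M)^T x +
      @hpair k ((row i N)^T, - z i 0) (y, 1).
    by exists x => i; rewrite F.
  by rewrite /hpair /=; lra.
move=> yP; suff /gP[x xP] : forall j, 0 <= @hpair k (g j) (y, 1).
  by exists x => i; rewrite -F.
move=> j; have := yP (enum_rank j).
by rewrite E !mxE enum_rankK /hpair /=; lra.
Qed.

End Elimination.

(** * Faces of polyhedra *)

Section Faces.
Variables (R : realType) (k : nat).
Notation V := ('cV[R]_k).
Implicit Types (y z : V) (l e : R) (B F : set V).

Lemma convex_setP B : convex_set B <->
  forall y z l, B y -> B z -> 0 <= l -> l <= 1 -> B (l *: y + (1 - l) *: z).
Proof.
split=> [Bc y z l By Bz l0 l1|Bc y z l].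
  by have /(_ (mem_set By) (mem_set Bz)) := Bc y z (Itv01 l0 l1); rewrite inE.
by rewrite !inE => By Bz; exact: Bc.
Qed.

(** Affine functions, defined as those that preserve affine combinations. *)
Definition affine_fun (g : V -> R) :=
  forall y z l, g (l *: y + (1 - l) *: z) = l * g y + (1 - l) * g z.

(** The common zeros of affine functions that are nonnegative on a convex set
    form a face of it. *)
Lemma zeros_face (W : Type) (D : set W) (h : W -> V -> R) B :
  convex_set B -> (forall w, D w -> affine_fun (h w)) ->
  (forall w y, D w -> B y -> 0 <= h w y) ->
  face [set y | B y /\ forall w, D w -> h w y = 0] B.
Proof.
move=> /convex_setP Bc ha h0; split.
- apply/convex_setP => y z l [By hy] [Bz hz] l0 l1; split; first exact: Bc.
  by move=> w Dw; rewrite (ha w Dw) hy // hz // !mulr0 addr0.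
- by move=> y [].
- move=> y z l By Bz l0 l1 [_ hyz].
  suff H w : D w -> h w y = 0 /\ h w z = 0.
    by split; split=> // w /H[].
  move=> Dw; have := hyz w Dw; rewrite (ha w Dw).
  by have := h0 w y Dw By; have := h0 w z Dw Bz; split; nra.
Qed.

(** Nonnegative slacks [s] stay nonnegative under a small enough change along
    [x], provided that [x] does not decrease those that vanish. *)
Lemma small_step (I : finType) (s x : I -> R) :
  (forall i, 0 <= s i) -> (forall i, s i = 0 -> 0 <= x i) ->
  exists2 e, 0 < e & forall i, 0 <= s i + e * x i.
Proof.
move=> s0 sx; pose S := \sum_i `|x i| / s i.
have S0 : 0 <= S by apply: sumr_ge0 => i _; rewrite divr_ge0.
exists (1 + S)^-1; first by rewrite invr_gt0; lra.
move=> i; have [si0|si0] := eqVneq (s i) 0.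
  by rewrite si0 add0r mulr_ge0 ?sx // invr_ge0; lra.
have sp : 0 < s i by rewrite lt_neqAle eq_sym si0 s0.
have : `|x i| / s i <= S.
  by rewrite /S (bigD1 i) //= lerDl sumr_ge0 // => j _; rewrite divr_ge0.
rewrite ler_pdivrMr // => xS.
have -> : s i + (1 + S)^-1 * x i = (s i * (1 + S) + x i) / (1 + S).
  by field; lra.
by rewrite divr_ge0 //; [have := ler_norm (- x i); rewrite normrN; lra|lra].
Qed.

Lemma affine_step (g : V -> R) y z e : affine_fun g ->
  g (y + e *: (z - y)) = g y + e * (g z - g y).
Proof.
move=> ga.
have -> : y + e *: (z - y) = e *: z + (1 - e) *: y.
  by rewrite scalerBl scale1r scalerBr addrC -addrA (addrC y).
by rewrite ga; ring.
Qed.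

(** From a point [y] of a polyhedron one can move towards [z] as soon as [z]
    satisfies the constraints that are active at [y]. *)
Lemma feasible_step (I : finType) (g : I -> V -> R) y z :
  (forall i, affine_fun (g i)) -> (forall i, 0 <= g i y) ->
  (forall i, g i y = 0 -> 0 <= g i z) ->
  exists2 e, 0 < e & forall i, 0 <= g i (y + e *: (z - y)).
Proof.
move=> ga y0 yz.
have [|e e0 eP] := @small_step I (fun i => g i y) (fun i => g i z - g i y) y0.
  by move=> i /[dup] gy /yz; rewrite gy subr0.
by exists e => // i; rewrite affine_step.
Qed.

(** A nonempty face of a polyhedron has a point, of least active set, such that
    the face consists of the points where the constraints active there are
    active. *)
Lemma face_active (I : finType) (g : I -> V -> R) F :
  (forall i, affine_fun (g i)) -> face F [set y | forall i, 0 <= g i y] ->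
  F !=set0 -> exists2 y0, F y0 &
    F = [set y | (forall i, 0 <= g i y) /\ forall i, g i y0 = 0 -> g i y = 0].
Proof.
move=> ga [/convex_setP Fc Fsub Fface] [y1 Fy1].
pose act y := [set i | g i y == 0]%SET.
(* y0 has the fewest active constraints; by convexity of F they are then active
   at every point of F *)
pose Q (J : {set I}) := `[< exists2 y, F y & act y = J >].
have Q1 : Q (act y1) by apply/asboolP; exists y1.
have [J /asboolP[y0 Fy0 <-] Jmin] := arg_minnP (fun J : {set I} => #|J|) Q1.
have zero i y : (i \in act y) = (g i y == 0) by rewrite finset.inE.
have sub y : F y -> act y0 \subset act y.
  move=> Fy; pose m := (1 / 2) *: y0 + (1 - 1 / 2) *: y.
  have Fm : F m by apply: Fc => //; lra.
  have mE i : i \in act m -> i \in act y0 /\ i \in act y.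
    rewrite !zero => /eqP; rewrite /m ga.
    have := Fsub _ Fy0 i; have := Fsub _ Fy i => a0 b0 H.
    by split; apply/eqP; lra.
  have Qm : Q (act m) by apply/asboolP; exists m.
  have /eqP <- : act m == act y0.
    by rewrite eqEcard Jmin // andbT; apply/fintype.subsetP => i /mE[].
  by apply/fintype.subsetP => i /mE[].
exists y0 => //; apply/seteqP; split=> [y Fy|y [yP yact]].
  split; first exact: Fsub.
  move=> i iy0; have /fintype.subsetP/(_ i) := sub _ Fy; rewrite !zero iy0 eqxx.
  by move=> /(_ isT)/eqP.
(* the segment from y to y0 can be extended a little beyond y0 *)
pose z : V := y0 + (y0 - y).
have zE : z = 2 *: y0 + (1 - 2) *: y.
  have -> : 1 - 2 = -1 :> R by ring.
  by rewrite /z scaleN1r scaler_nat mulr2n addrA.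
have [||e e0 eP] := feasible_step (y := y0) (z := z) ga.
- exact: Fsub.
- by move=> i gy0; rewrite zE ga yact // gy0 !mulr0 addr0.
have e1 : 0 < (1 + e)^-1 by rewrite invr_gt0; lra.
have := Fface (y0 + e *: (z - y0)) y (1 + e)^-1 eP yP e1.
have -> : (1 + e)^-1 *: (y0 + e *: (z - y0)) + (1 - (1 + e)^-1) *: y = y0.
  apply/matrixP => i j; rewrite /z !mxE; field.
  by rewrite gt_eqF //; clear -e0; lra.
by case=> //; rewrite invf_lt1; lra.
Qed.

End Faces.

(** * Dimension of a convex set *)

Lemma vspace_of_mx (R : realType) (r k : nat) (M : 'M[R]_(r, k)) :
  exists U : {vspace 'cV[R]_k},
    (forall u, u \in U = (u^T <= M)%MS) /\ \dim U = \rank M.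
Proof.
pose f : {linear 'rV[R]_(\rank M) -> 'cV[R]_k} :=
  @trmx R 1 k \o mulmxr (row_base M).
exists (limg (linfun f)); split=> [u|].
  apply/memv_imgP/idP => [[v _ ->]|].
    rewrite lfunE /= /f trmxK.
    by rewrite (eqmxMr _ (eqmx_refl _)) -(eq_row_base M) submxMl.
  rewrite -(eq_row_base M) => /submxP[v vP]; exists v; first exact: memvf.
  by rewrite lfunE /= /f -vP trmxK.
rewrite limg_dim_eq; first by rewrite dimvf; exact: mul1n.
apply/eqP; rewrite -subv0 capfv; apply/subvP => v; rewrite memv_ker lfunE /= /f.
move=> /eqP H; rewrite memv0; apply/eqP.
apply: (row_free_inj (row_base_free M)); rewrite mul0mx.
by rewrite -[LHS]trmxK H trmx0.
Qed.

(** If [E] lies in the affine space through [a] directed by the row space of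
    [M], and contains a small step from [a] in each of its directions, then the
    dimension of [E] is the rank of [M]. *)
Lemma affdim_rank (R : realType) (r k : nat) (E : set 'cV[R]_k)
    (M : 'M[R]_(r, k)) a :
  E a -> (forall y, E y -> ((y - a)^T <= M)%MS) ->
  (forall u : 'cV[R]_k, (u^T <= M)%MS -> exists2 e, 0 < e & E (a + e *: u)) ->
  affdim E = \rank M.
Proof.
move=> Ea EM Me; have [U0 [U0M <-]] := vspace_of_mx M.
have hullE : affine_hull E = [set a + u | u in [set` U0]].
  apply/seteqP; split.
    apply: smallest_sub => [y z l [u /= Uu <-] [v /= Uv <-]|y Ey].
      exists ((1 - l) *: u + l *: v) => /=; first by rewrite memvD // memvZ.
      by apply/matrixP => i j; rewrite !mxE; ring.
    by exists (y - a); rewrite /= ?U0M ?EM // addrC subrK.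
  move=> _ [u /= Uu <-] B [Baff EB].
  have [|e e0 Ee] := Me u; first by rewrite -U0M.
  have := Baff a (a + e *: u) e^-1 (EB _ Ea) (EB _ Ee).
  congr (B _); apply/matrixP => i j; rewrite !mxE; field; lra.
rewrite /affdim; set Q := [set U : {vspace 'cV[R]_k} | _].
have : Q U0 by exists a => //; apply: sub_gen_smallest.
move=> /(xgetI 0%VS); set U := xget _ _ => -[b bE]; rewrite hullE => UE.
have aE : [set b + u | u in [set` U]] a.
  by rewrite -UE; exists 0; rewrite /= ?mem0v ?addr0.
have bE' : [set a + u | u in [set` U0]] b by rewrite -hullE.
have [w /= wU0 bw] := bE'.
congr (\dim _); apply/vspaceP => u; apply/idP/idP => uU.
  have : [set b + u | u in [set` U]] (b + u) by exists u.
  rewrite -UE => -[v /= vU0] /eqP; rewrite -bw -addrA (inj_eq (addrI _)) => /eqP vE.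
  by rewrite -(addKr w u) -vE memvD // memvN.
have [v /= vU va] := aE.
have : [set a + u | u in [set` U0]] (a + u) by exists u.
rewrite UE => -[v' /= v'U] /eqP; rewrite -va -addrA (inj_eq (addrI _)) => /eqP vE.
by rewrite -(addKr v u) -vE memvD // memvN.
Qed.

(** * The coupling function *)

Section Coupling.
Variables (R : realType) (q : nat) (c : 'cV[R]_(q.+1 + 1)).
Notation V := ('cV[R]_q.+1).
Notation p := (pvec c).
Hypothesis p_max : p ord_max 0 = 1.
Implicit Types (w y : V) (t l : R).

(** The dual vector encoded by a point of the lower image: its last coordinate
    is the one that makes its product with [p] equal to 1. *)
Definition lift w : V :=
  \col_i (if i == ord_max then 1 - \sum_(j | j != ord_max) p j 0 * w j 0
          else w i 0).

(** Conversely, the point with objective value [t] that encodes [w]; it forgets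
    the last coordinate of [w]. *)
Definition unlift w t : V := \col_i (if i == ord_max then t else w i 0).

Lemma dotp_max w y :
  dotp w y = \sum_(i | i != ord_max) w i 0 * y i 0 + w ord_max 0 * y ord_max 0.
Proof. by rewrite dotpE (bigD1 ord_max) //= addrC. Qed.

Lemma lift_max w :
  lift w ord_max 0 = 1 - \sum_(j | j != ord_max) p j 0 * w j 0.
Proof. by rewrite mxE eqxx. Qed.

Lemma lift_neq w i : i != ord_max -> lift w i 0 = w i 0.
Proof. by rewrite mxE => /negbTE ->. Qed.

Lemma unlift_max w t : unlift w t ord_max 0 = t.
Proof. by rewrite mxE eqxx. Qed.

Lemma unlift_neq w t i : i != ord_max -> unlift w t i 0 = w i 0.
Proof. by rewrite mxE => /negbTE ->. Qed.

Lemma phiE y w : phi c y w = dotp (lift w) y - w ord_max 0.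
Proof.
rewrite /phi dotp_max lift_max [y _ _ * _]mulrC; congr (_ + _ - _).
by apply: eq_bigr => i im; rewrite lift_neq // mulrC.
Qed.

Lemma dotp_lift w : dotp p (lift w) = 1.
Proof.
rewrite dotp_max p_max lift_max mul1r.
under eq_bigr => i im do rewrite lift_neq //.
by rewrite addrC subrK.
Qed.

Lemma lift_unlift w t : dotp p w = 1 -> lift (unlift w t) = w.
Proof.
move=> pw; apply/matrixP => i j; rewrite (ord1 j).
have [->|im] := eqVneq i ord_max; last by rewrite lift_neq // unlift_neq.
rewrite lift_max; under eq_bigr => l lm do rewrite unlift_neq //.
by move: pw; rewrite dotp_max p_max; lra.
Qed.

Lemma lift_affine w w' l :
  lift (l *: w + (1 - l) *: w') = l *: lift w + (1 - l) *: lift w'.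
Proof.
apply/matrixP => i j; rewrite (ord1 j).
rewrite [RHS]mxE [X in _ = X + _]mxE [X in _ = _ + X]mxE.
have [->|im] := eqVneq i ord_max; last by rewrite !lift_neq // !mxE.
rewrite !lift_max.
have -> : \sum_(j | j != ord_max) p j 0 * (l *: w + (1 - l) *: w') j 0 =
    l * (\sum_(j | j != ord_max) p j 0 * w j 0) +
    (1 - l) * (\sum_(j | j != ord_max) p j 0 * w' j 0).
  rewrite !mulr_sumr -big_split /=; apply: eq_bigr => k _.
  have -> : (l *: w + (1 - l) *: w') k 0 = l * w k 0 + (1 - l) * w' k 0.
    by rewrite !mxE.
  by ring.
by ring.
Qed.

Lemma eq_lift w w' : (forall i, i != ord_max -> w i 0 = w' i 0) ->
  lift w = lift w'.
Proof.
move=> ww'; apply/matrixP => i j; rewrite (ord1 j).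
have [->|im] := eqVneq i ord_max; last by rewrite !lift_neq // ww'.
by rewrite !lift_max; congr (1 - _); apply: eq_bigr => k /ww' ->.
Qed.

Lemma phi_affinel w : affine_fun (phi c ^~ w).
Proof. by move=> y z l; rewrite !phiE dotpDr !dotpZr; ring. Qed.

Lemma phi_affiner y : affine_fun (phi c y).
Proof.
move=> w w' l; rewrite !phiE lift_affine dotpDl !dotpZl.
by rewrite !mxE; ring.
Qed.

Lemma phi_translate y w l : phi c (y + l *: p) w = phi c y w + l.
Proof. by rewrite !phiE dotpDr dotpZr (dotpC _ p) dotp_lift; ring. Qed.

Lemma phi_unlift y w t : dotp p w = 1 -> phi c y (unlift w t) = dotp w y - t.
Proof. by move=> pw; rewrite phiE lift_unlift // unlift_max. Qed.

Lemma phi_comb r (Z : 'M[R]_(r, q.+1)) (z u : 'cV[R]_r) y :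
  dotp p (Z^T *m u) = 1 -> phi c y (unlift (Z^T *m u) (dotp z u)) =
    \sum_i u i 0 * ((Z *m y) i 0 - z i 0).
Proof.
move=> pu; rewrite phi_unlift // dotp_trmul (dotpC z) !dotpE -sumrB.
by apply: eq_bigr => i _; rewrite mulrBr.
Qed.

(** The last axis, along which objective values vary. *)
Definition emax : V := delta_mx ord_max 0.

Lemma add_emax_neq w l i : i != ord_max -> (w + l *: emax) i 0 = w i 0.
Proof. by move=> /negbTE im; rewrite !mxE im mulr0 addr0. Qed.

Lemma lift_emax w l : lift (w + l *: emax) = lift w.
Proof. by apply: eq_lift => i; exact: add_emax_neq. Qed.

Lemma add_emax_max w l : (w + l *: emax) ord_max 0 = w ord_max 0 + l.
Proof. by rewrite !mxE !eqxx mulr1. Qed.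

End Coupling.

(** * Upper and lower images *)

Section Images.
Variables (R : realType) (n m q : nat).
Variables (A : 'M[R]_(m, n)) (P : 'M[R]_(q.+1, n)) (b : 'cV[R]_m).
Variables (C : set 'cV[R]_q.+1) (c : 'cV[R]_(q.+1 + 1)).
Notation V := ('cV[R]_q.+1).
Notation p := (pvec c).
Hypothesis C_polycone : polyhedral_convex_cone C.
Hypothesis S_nonempty : feasible A b !=set0.
Hypothesis Cp : C p.
Hypothesis p_max : p ord_max 0 = 1.
Implicit Types (w y : V) (F Fs : set V).

Notation Pimg := (upper_image A P b C).
Notation Dimg := (lower_image A P b C c).
Notation Dfaces := (maximal_proper_faces (@Rstar R q) Dimg).
Notation Pfaces := (minimal_proper_faces (ray p) Pimg).
Notation Psi := (Psi A P b C c).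
Notation Psi_inv := (Psi_inv A P b C c).
Notation phi := (phi c).

Lemma cone0 : C 0.
Proof. by case: C_polycone => _ _ [[y Cy] /(_ 0 y)]; rewrite scale0r; apply. Qed.

Lemma coneZ l y : 0 <= l -> C y -> C (l *: y).
Proof. by case: C_polycone => _ _ [_]; apply. Qed.

Lemma coneD y z : C y -> C z -> C (y + z).
Proof.
move=> Cy Cz; have -> : y + z = 2 *: ((1 / 2) *: y + (1 - 1 / 2) *: z).
  by apply/matrixP => i j; rewrite !mxE; field.
apply: coneZ => //; case: C_polycone => _ /convex_setP Cc _.
by apply: Cc => //; lra.
Qed.

Lemma upper_addC y z : Pimg y -> C z -> Pimg (y + z).
Proof.
move=> [_ [x Sx <-]] [k Ck <-] Cz; exists (P *m x); first by exists x.
by exists (k + z); [exact: coneD|rewrite addrA].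
Qed.

Lemma upper_neq0 : Pimg !=set0.
Proof.
have [x Sx] := S_nonempty; exists (P *m x + 0), (P *m x); first by exists x.
by exists 0 => //; exact: cone0.
Qed.

Lemma upper_hrep : exists (r : nat) (Z : 'M[R]_(r, q.+1)) (z : 'cV[R]_r),
  Pimg = [set y | forall i, z i 0 <= (Z *m y) i 0].
Proof.
have [[r [K [h CE]]] _ _] := C_polycone.
suff -> : Pimg = [set y | exists x, forall i, col_mx b h i 0 <=
    (col_mx A (- (K *m P)) *m x + col_mx 0 K *m y) i 0].
  exact: polyhedron_proj.
have E x y i : (col_mx A (- (K *m P)) *m x + col_mx 0 K *m y) i 0 =
    (col_mx (A *m x) (K *m (y - P *m x))) i 0.
  rewrite !mul_col_mx add_col_mx mul0mx addr0 mulNmx mulmxBr mulmxA.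
  by rewrite (addrC (- _)).
apply/seteqP; split=> y.
  move=> [_ [x Sx <-]] [k Ck <-]; exists x => i; rewrite E addrC addKr.
  rewrite -(fintype.splitK i); case: (fintype.split i) => j /=;
    rewrite ?col_mxEu ?col_mxEd.
    exact: Sx.
  by move: Ck; rewrite CE; apply.
move=> [x xP]; exists (P *m x).
  exists x => // j; have := xP (lshift _ j).
  by rewrite E !col_mxEu.
exists (y - P *m x); last by rewrite addrC subrK.
rewrite CE => j; have := xP (rshift _ j).
by rewrite E !col_mxEd.
Qed.

(** Weak and strong linear programming duality in one statement: the lower image
    is the set of the affine functions [phi _ w] that are nonnegative on the
    upper image. *)
Lemma lower_imageP w : Dimg w <-> forall y, Pimg y -> 0 <= phi y w.
Proof.
split=> [[_ [[u v] [/= Auv pv [v' v'C v'E] u0] <-]] [_ [r [r0 rm] <-] <-] y|wP].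
  move=> [_ [x Sx <-]] [k Ck <-]; rewrite phiE.
  have -> : lift c (dual_obj b (u, v) - r) = v.
    rewrite -[RHS](lift_unlift p_max (dotp b u)) //; apply: eq_lift => i im.
    by rewrite !mxE (negbTE im) r0 // subr0.
  have -> : (dual_obj b (u, v) - r) ord_max 0 = dotp b u - r ord_max 0.
    by rewrite !mxE eqxx.
  have vk : 0 <= dotp v k by rewrite -v'E dotpNl oppr_ge0 v'C.
  have : dotp b u <= dotp v (P *m x).
    by rewrite -dotp_trmul -Auv dotp_trmul dotpC ler_dotp.
  by rewrite dotpDr; lra.
have [x0 Sx0] := S_nonempty.
have inP x k : feasible A b x -> C k -> Pimg (P *m x + k).
  by move=> Sx Ck; exists (P *m x); [exists x|exists k].
pose t := w ord_max 0.
have wk k : C k -> 0 <= dotp (lift c w) k.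
  move=> Ck; rewrite leNgt; apply/negP => wk0.
  pose l := (dotp (lift c w) (P *m x0) - t + 1) / - dotp (lift c w) k.
  have /wP : Pimg (P *m x0 + 0) by apply: inP => //; exact: cone0.
  rewrite addr0 phiE -/t => t0.
  have l0 : 0 <= l by rewrite divr_ge0 //; lra.
  have /wP : Pimg (P *m x0 + l *: k) by apply: inP => //; exact: coneZ.
  rewrite phiE -/t dotpDr dotpZr.
  have -> : l * dotp (lift c w) k = - (dotp (lift c w) (P *m x0) - t + 1).
    by rewrite /l; field; rewrite lt_eqF.
  by lra.
have [|u [u0 Au tu]] := farkas (w := P^T *m lift c w) (t := t) Sx0.
  move=> x Sx; have /wP : Pimg (P *m x + 0) by apply: inP => //; exact: cone0.
  by rewrite addr0 phiE dotp_trmul subr_ge0.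
exists (dual_obj b (u, lift c w)).
  exists (u, lift c w) => //; split=> //=; first exact: dotp_lift.
  exists (- lift c w); last by rewrite opprK.
  by move=> k /wk; rewrite dotpNl oppr_le0.
exists (- ((dotp b u - t) *: emax R q)).
  exists ((dotp b u - t) *: emax R q) => //; split.
    by move=> i /negbTE im; rewrite !mxE im mulr0.
  by rewrite !mxE !eqxx mulr1 subr_ge0.
apply/matrixP => i j; rewrite (ord1 j) -scaleNr.
have [->|im] := eqVneq i ord_max.
  by rewrite add_emax_max [dual_obj _ _ _ _]mxE eqxx /= /t; ring.
by rewrite add_emax_neq // [dual_obj _ _ _ _]mxE (negbTE im) /= lift_neq.
Qed.

(** Normalized nonnegative combinations of constraints of the upper image are
    points of the lower image. *)
Lemma lower_comb r (Z : 'M[R]_(r, q.+1)) (z : 'cV[R]_r) (u : 'cV[R]_r) :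
  Pimg = [set y | forall i, z i 0 <= (Z *m y) i 0] ->
  (forall i, 0 <= u i 0) -> dotp p (Z^T *m u) = 1 ->
  Dimg (unlift (Z^T *m u) (dotp z u)).
Proof.
move=> PE u0 pu; apply/lower_imageP => y; rewrite PE => yP.
rewrite phi_unlift // dotp_trmul (dotpC z) subr_ge0; exact: ler_dotp.
Qed.

Lemma lower_sub_emax w l : Dimg w -> 0 <= l -> Dimg (w - l *: emax R q).
Proof.
move=> /lower_imageP wP l0; apply/lower_imageP => y /wP.
by rewrite !phiE -scaleNr lift_emax add_emax_max; lra.
Qed.

Lemma upper_convex : convex_set Pimg.
Proof.
have [r [Z [z ->]]] := upper_hrep; apply/convex_setP => x y l xP yP l0 l1 i.
rewrite mulmxDr -!scalemxAr !mxE; have := xP i; have := yP i; rewrite !mxE.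
nra.
Qed.

Lemma lower_convex : convex_set Dimg.
Proof.
apply/convex_setP => w w' l /lower_imageP wP /lower_imageP wP' l0 l1.
apply/lower_imageP => y yP; rewrite phi_affiner.
by have := wP y yP; have := wP' y yP; nra.
Qed.

Lemma pvec_neq0 : p != 0.
Proof.
apply/eqP => p0; have := p_max; rewrite p0 mxE => /esym/eqP.
by rewrite oner_eq0.
Qed.

Lemma upper_minimal y e : minimal_pts (ray p) Pimg y -> 0 < e ->
  ~ Pimg (y - e *: p).
Proof.
move=> [_ ymin] e0 H; apply: ymin; exists (y - e *: p) => //.
exists (e *: p); last by rewrite subrK.
split; first by exists e => //; exact: ltW.
by move=> /eqP; rewrite scaler_eq0 (negbTE pvec_neq0) orbF gt_eqF.
Qed.

Lemma lower_maximal w e : maximal_pts (@Rstar R q) Dimg w -> 0 < e ->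
  ~ Dimg (w + e *: emax R q).
Proof.
move=> [_ wmax] e0 H; apply: wmax; exists (w + e *: emax R q) => //.
exists (- (e *: emax R q)); last by rewrite addrK.
split.
  exists (e *: emax R q) => //; split.
    by move=> i /negbTE im; rewrite !mxE im mulr0.
  by rewrite !mxE !eqxx mulr1 ltW.
move=> /= /matrixP/(_ ord_max 0); rewrite !mxE !eqxx mulr1 => /eqP.
by rewrite oppr_eq0 gt_eqF.
Qed.

Lemma upper_zero_minimal y w : Pimg y -> Dimg w -> phi y w = 0 ->
  minimal_pts (ray p) Pimg y.
Proof.
move=> Py /lower_imageP wP yw; split=> // -[y' y'P [_ [[l /= l0 <-] l1]]] yE.
have := wP _ y'P; move: yw; rewrite -yE phi_translate //.
suff : 0 < l by lra.
rewrite lt_neqAle eq_sym l0 andbT; apply/eqP => lE.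
by apply: l1; rewrite lE /= scale0r.
Qed.

Lemma lower_zero_maximal y w : Pimg y -> Dimg w -> phi y w = 0 ->
  maximal_pts (@Rstar R q) Dimg w.
Proof.
move=> Py Dw yw; split=> // -[w' /lower_imageP/(_ y Py) w'P].
move=> [_ [[r [r0 rm] <-] rN]] wE; move: yw w'P; rewrite !phiE -wE.
have -> : lift c (w' - r) = lift c w'.
  by apply: eq_lift => i /r0 ri; rewrite !mxE ri subr0.
have -> : (w' - r) ord_max 0 = w' ord_max 0 - r ord_max 0 by rewrite !mxE.
suff : 0 < r ord_max 0 by lra.
rewrite lt_neqAle eq_sym rm andbT; apply/eqP => rE; apply: rN => /=.
apply/matrixP => i j; rewrite (ord1 j) !mxE.
by have [->|/r0 ->] := eqVneq i ord_max; rewrite ?rE oppr0.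
Qed.

Lemma PsiE Fs : Fs !=set0 ->
  Psi Fs = [set y | Pimg y /\ forall w, Fs w -> phi y w = 0].
Proof.
move=> [w0 w0F]; apply/seteqP; split=> y.
  by move=> H; split=> [|w wF]; [case: (H w0 w0F)|case: (H w wF)].
by move=> [Py yF] w wF; split=> //; exact: yF.
Qed.

Lemma Psi_invE F : F !=set0 ->
  Psi_inv F = [set w | Dimg w /\ forall y, F y -> phi y w = 0].
Proof.
move=> [y0 y0F]; apply/seteqP; split=> w.
  by move=> H; split=> [|y yF]; [case: (H y0 y0F)|case: (H y yF)].
by move=> [Dw wF] y yF; split=> //; exact: wF.
Qed.

(** A nonempty set of common zeros is a proper face: translating one of its
    points along [p] leaves it. *)
Lemma Psi_minimal_face Fs : Fs !=set0 -> Fs `<=` Dimg -> Psi Fs !=set0 ->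
  Pfaces (Psi Fs).
Proof.
move=> Fs0 FsD; rewrite PsiE // => Psi0; have [w wF] := Fs0.
split=> [|y [Py yF]]; last exact: upper_zero_minimal (FsD _ wF) (yF _ wF).
split=> //.
  apply: zeros_face => [|v vF|v y vF Py].
  - exact: upper_convex.
  - exact: phi_affinel.
  - by have /lower_imageP := FsD _ vF; apply.
move=> PsiP; have [y [Py yF]] := Psi0.
have : Pimg (y + 1 *: p) by apply: upper_addC => //; rewrite scale1r.
rewrite -PsiP => -[_ /(_ w wF)]; rewrite phi_translate // yF // add0r => /eqP.
by rewrite oner_eq0.
Qed.

Lemma Psi_inv_maximal_face F : F !=set0 -> F `<=` Pimg -> Psi_inv F !=set0 ->
  Dfaces (Psi_inv F).
Proof.
move=> F0 FP; rewrite Psi_invE // => Psi0; have [y yF] := F0.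
split=> [|w [Dw wF]]; last exact: lower_zero_maximal (FP _ yF) Dw (wF _ yF).
split=> //.
  apply: (zeros_face (h := phi)) => [|v vF|v w vF Dw].
  - exact: lower_convex.
  - exact: phi_affiner.
  - by have /lower_imageP/(_ v (FP _ vF)) := Dw.
move=> PsiD; have [w [Dw wF]] := Psi0.
have := lower_sub_emax Dw ler01.
rewrite -PsiD => -[_ /(_ y yF)].
rewrite phiE -scaleNr lift_emax add_emax_max => H.
by have := wF _ yF; rewrite phiE; lra.
Qed.

(** A minimal face of the upper image is cut out by the constraints active at
    one of its points, and a combination of exactly these constraints, with
    positive weights, has normal vector of product 1 with [p]. *)
Lemma minimal_face_active r (Z : 'M[R]_(r, q.+1)) (z : 'cV[R]_r) F :
  Pimg = [set y | forall i, z i 0 <= (Z *m y) i 0] -> Pfaces F ->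
  exists (y0 : V) (u : 'cV[R]_r), [/\ F y0,
    F = [set y | Pimg y /\ forall i, (Z *m y0) i 0 = z i 0 ->
                                    (Z *m y) i 0 = z i 0],
    forall i, (Z *m y0) i 0 = z i 0 -> 0 < u i 0,
    forall i, (Z *m y0) i 0 <> z i 0 -> u i 0 = 0 &
    dotp p (Z^T *m u) = 1].
Proof.
move=> PE [[Fface F0 _] Fmin].
pose g (i : 'I_r) (y : V) := (Z *m y) i 0 - z i 0.
have ga i : affine_fun (g i).
  by move=> x y l; rewrite /g mulmxDr -!scalemxAr !mxE; ring.
have PE' : Pimg = [set y | forall i, 0 <= g i y].
  by rewrite PE; apply/seteqP; split=> y yP i; have := yP i; rewrite /g subr_ge0.
have g0 i y : (g i y = 0) <-> ((Z *m y) i 0 = z i 0).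
  by rewrite /g; split; lra.
have [y0 Fy0 FE] : exists2 y0, F y0 & F = [set y | (forall i, 0 <= g i y) /\
    forall i, g i y0 = 0 -> g i y = 0].
  by apply: face_active => //; rewrite -PE'.
have Py0 : Pimg y0 by case: Fface => _ + _; apply.
pose rho := \sum_(i | (Z *m y0) i 0 == z i 0) (Z *m p) i 0.
suff rho0 : 0 < rho.
  exists y0, (\col_i (if (Z *m y0) i 0 == z i 0 then rho^-1 else 0)); split=> //.
  - rewrite PE' {1}FE; apply/seteqP; split=> y [yP yF]; split=> // i.
      by move=> /g0/yF/g0.
    by move=> /g0/yF/g0.
  - by move=> i yi; rewrite mxE yi eqxx invr_gt0.
  - by move=> i /eqP/negbTE yi; rewrite mxE yi.
  - rewrite dotpC dotp_trmul dotpE -(mulVf (lt0r_neq0 rho0)) mulr_sumr.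
    rewrite [RHS]big_mkcond /=; apply: eq_bigr => i _.
    by rewrite [X in X * _]mxE; case: ifP => // _; rewrite mul0r.
have Zp i : 0 <= (Z *m p) i 0.
  rewrite leNgt; apply/negP => Zp0.
  pose l := ((Z *m y0) i 0 - z i 0 + 1) / - (Z *m p) i 0.
  have zy : z i 0 <= (Z *m y0) i 0 by move: Py0; rewrite PE; apply.
  have l0 : 0 <= l by rewrite divr_ge0 //; lra.
  have : Pimg (y0 + l *: p) by apply: upper_addC => //; exact: coneZ.
  rewrite PE => /(_ i).
  have -> : (Z *m (y0 + l *: p)) i 0 = (Z *m y0) i 0 + l * (Z *m p) i 0.
    by rewrite mulmxDr -scalemxAr [LHS]mxE [X in _ + X]mxE.
  have -> : l * (Z *m p) i 0 = - ((Z *m y0) i 0 - z i 0 + 1).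
    by rewrite /l; field; rewrite lt_eqF.
  by lra.
rewrite lt_neqAle sumr_ge0 // andbT eq_sym; apply/eqP => /psumr_eq0P S0.
have [||e e0 eP] := @feasible_step _ _ _ g y0 (y0 - p) ga.
- by move=> i; have : Pimg y0 := Py0; rewrite PE'; apply.
- move=> i /g0 gi; have Zpi : (Z *m p) i 0 = 0 by apply: S0 => //; exact/eqP.
  rewrite /g mulmxBr.
  have -> : (Z *m y0 - Z *m p) i 0 = (Z *m y0) i 0 - (Z *m p) i 0.
    by rewrite [LHS]mxE [X in _ + X]mxE.
  by rewrite gi Zpi; lra.
apply: (upper_minimal (Fmin _ Fy0) e0); rewrite PE'.
have -> : y0 - e *: p = y0 + e *: (y0 - p - y0).
  by rewrite [y0 - p]addrC addrK scalerN.
exact: eP.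
Qed.

(** A maximal face of the lower image is exposed by a point of the upper image,
    obtained from the sum of its active constraints. *)
Lemma maximal_face_exposed Fs : Dfaces Fs ->
  exists2 y, Pimg y & Fs = [set w | Dimg w /\ phi y w = 0].
Proof.
move=> [[Fface F0 _] Fmax]; have [r [Z [z PE]]] := upper_hrep.
have [J [a [s [key s0 Zs]]]] := dual_cone_hrep Z z.
pose g j w := dotp (a j) (lift c w) + s j * w ord_max 0.
have ga j : affine_fun (g j).
  move=> w w' l; rewrite /g lift_affine dotpDr !dotpZr.
  by have -> : (l *: w + (1 - l) *: w') ord_max 0 =
    l * w ord_max 0 + (1 - l) * w' ord_max 0; [rewrite !mxE|ring].
have [y1 y1P] : exists y, forall i, z i 0 <= (Z *m y) i 0.
  by have [y] := upper_neq0; rewrite PE; exists y.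
have DE : Dimg = [set w | forall j, 0 <= g j w].
  apply/seteqP; split=> w.
    move=> /lower_imageP wP; apply/key; apply: (farkas y1P) => y yP.
    by have := wP y; rewrite PE phiE => /(_ yP); lra.
  move=> /key[u [u0 uE tu]]; apply/lower_imageP => y; rewrite PE => yP.
  by rewrite phiE -uE dotp_trmul; have := ler_dotp u0 yP; rewrite (dotpC u z); lra.
have [w0 Fw0 FE] : exists2 w0, Fs w0 & Fs = [set w | (forall j, 0 <= g j w) /\
    forall j, g j w0 = 0 -> g j w = 0].
  by apply: face_active => //; rewrite -DE.
have Dw0 j : 0 <= g j w0.
  by have : Dimg w0 by [case: Fface => _ + _; apply]; rewrite DE; apply.
pose S := \sum_(j | g j w0 == 0) s j.
pose aS := \sum_(j | g j w0 == 0) a j.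
have S0 : S < 0.
  rewrite -oppr_gt0 /S -sumrN lt_neqAle sumr_ge0 => [|j _]; last first.
    by rewrite oppr_ge0.
  rewrite andbT eq_sym; apply/eqP => /psumr_eq0P H.
  have [||e e0 eP] := @feasible_step _ _ _ g w0 (w0 + 1 *: emax R q) ga.
  - exact: Dw0.
  - move=> j gj; have : - s j = 0.
      by apply: H => [i _|]; rewrite ?oppr_ge0 //; exact/eqP.
    move: gj; rewrite /g lift_emax add_emax_max => gj sj.
    by rewrite mulrDr mulr1 addrA gj; lra.
  apply: (lower_maximal (Fmax _ Fw0) e0); rewrite DE.
  by move: eP; rewrite scale1r [w0 + emax R q]addrC addrK.
have gS w : \sum_(j | g j w0 == 0) g j w = dotp aS (lift c w) + S * w ord_max 0.
  by rewrite dotp_suml /S mulr_suml -big_split.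
exists ((- S)^-1 *: aS).
  rewrite PE => i; rewrite -scalemxAr [X in _ <= X]mxE mulrC.
  rewrite ler_pdivlMr ?oppr_gt0 // -subr_ge0 mulrN opprK.
  rewrite /aS mulmx_sumr summxE mulr_sumr -big_split sumr_ge0 //= => j _.
  by rewrite (mulrC (z i 0)); exact: Zs.
have phiS w : phi ((- S)^-1 *: aS) w = (- S)^-1 * \sum_(j | g j w0 == 0) g j w.
  by rewrite gS phiE dotpZr (dotpC (lift c w)); field; rewrite lt_eqF.
rewrite {1}FE DE; apply/seteqP; split=> w [Dw wF]; split=> //.
  rewrite phiS big1 ?mulr0 // => j /eqP; exact: wF.
move=> j gj; move: wF; rewrite phiS => /eqP.
rewrite mulf_eq0 invr_eq0 oppr_eq0 lt_eqF //= => /eqP/psumr_eq0P -> //.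
exact/eqP.
Qed.

(** A minimal face of the upper image is exposed by a point of the lower
    image. *)
Lemma minimal_face_exposed F : Pfaces F ->
  exists2 w, Dimg w & F = [set y | Pimg y /\ phi y w = 0].
Proof.
move=> FP; have [r [Z [z PE]]] := upper_hrep.
have [y0 [u [Fy0 FE upos u0 pu]]] := minimal_face_active PE FP.
have unneg i : 0 <= u i 0.
  have [/upos/ltW //|/u0 ->] := pselect ((Z *m y0) i 0 = z i 0); exact: lexx.
exists (unlift (Z^T *m u) (dotp z u)); first exact: lower_comb.
rewrite FE; apply/seteqP; split=> y [Py yF]; split=> //.
  rewrite phi_comb // big1 // => i _.
  have [/yF yi|/u0 ->] := pselect ((Z *m y0) i 0 = z i 0).
    by rewrite yi subrr mulr0.
  by rewrite mul0r.
move: yF; rewrite phi_comb //; move: Py; rewrite PE => Py.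
move=> /psumr_eq0P S0 i yi; have /eqP : u i 0 * ((Z *m y) i 0 - z i 0) = 0.
  by apply: S0 => // j _; rewrite mulr_ge0 // subr_ge0.
by rewrite mulf_eq0 gt_eqF ?upos //= subr_eq0 => /eqP.
Qed.

Lemma Psi_inv_neq0 F : Pfaces F -> Psi_inv F !=set0.
Proof.
move=> FP; have [w Dw FE] := minimal_face_exposed FP.
by exists w; rewrite FE => y [Py yw].
Qed.

Lemma Psi_neq0 Fs : Dfaces Fs -> Psi Fs !=set0.
Proof.
move=> FD; have [y Py FE] := maximal_face_exposed FD.
by exists y; rewrite FE => w [Dw yw].
Qed.

Lemma Psi_Dfaces Fs : Dfaces Fs -> Pfaces (Psi Fs).
Proof.
move=> FD; have [[[_ FsD _] Fs0 _] _] := FD.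
by apply: Psi_minimal_face => //; exact: Psi_neq0.
Qed.

Lemma Psi_inv_Pfaces F : Pfaces F -> Dfaces (Psi_inv F).
Proof.
move=> FP; have [[[_ FsP _] F0 _] _] := FP.
by apply: Psi_inv_maximal_face => //; exact: Psi_inv_neq0.
Qed.

Lemma PsiK Fs : Dfaces Fs -> Psi_inv (Psi Fs) = Fs.
Proof.
move=> FD; have [[[_ FsD _] _ _] _] := FD.
have [y Py FE] := maximal_face_exposed FD.
apply/seteqP; split=> [w|w wF z zF]; last first.
  by split; [exact: FsD|case: (zF w wF)].
by rewrite {2}FE => wP; apply: (wP y); rewrite FE => v [Dv yv].
Qed.

Lemma Psi_invK F : Pfaces F -> Psi (Psi_inv F) = F.
Proof.
move=> FP; have [[[_ FsP _] _ _] _] := FP.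
have [w Dw FE] := minimal_face_exposed FP.
apply/seteqP; split=> [y|y yF v vF]; last first.
  by split; [exact: FsP|case: (vF y yF)].
by rewrite {2}FE => yP; apply: (yP w); rewrite FE => v [Dv yv].
Qed.

(** The directions of a minimal face are the kernel of the matrix of its active
    constraints; those of the conjugate face correspond to the vectors of the
    row space of this matrix that are orthogonal to [p]. *)
Lemma affdim_Psi_inv F : Pfaces F ->
  (affdim (Psi_inv F) + affdim F)%N = q.
Proof.
move=> FP; have [r [Z [z PE]]] := upper_hrep.
have [y0 [u [Fy0 FE upos u0 pu]]] := minimal_face_active PE FP.
have FsE : Psi_inv F = [set w | Dimg w /\ forall y, F y -> phi y w = 0].
  by apply: Psi_invE; exists y0.
have Py0 : Pimg y0 by move: Fy0; rewrite FE => -[].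
have unneg i : 0 <= u i 0.
  have [/upos/ltW //|/u0 ->] := pselect ((Z *m y0) i 0 = z i 0); exact: lexx.
pose B : 'M[R]_(r, q.+1) :=
  \matrix_(i, j) (if (Z *m y0) i 0 == z i 0 then Z i j else 0).
have BE (d : V) i :
    (B *m d) i 0 = (if (Z *m y0) i 0 == z i 0 then (Z *m d) i 0 else 0).
  rewrite mxE; case: ifP => yi; last first.
    by apply: big1 => j _; rewrite mxE yi mul0r.
  by rewrite [RHS]mxE; apply: eq_bigr => j _; rewrite [B _ _]mxE yi.
have B0 (d : V) : B *m d = 0 <->
    forall i, (Z *m y0) i 0 = z i 0 -> (Z *m d) i 0 = 0.
  split=> [Bd i /eqP yi|dP].
    by have := BE d i; rewrite yi Bd mxE.
  apply/matrixP => i j; rewrite (ord1 j) BE [RHS]mxE.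
  by case: eqP => // yi; exact: dP.
have Zstep y e d i : (Z *m (y + e *: d)) i 0 = (Z *m y) i 0 + e * (Z *m d) i 0.
  by rewrite mulmxDr -scalemxAr [LHS]mxE [X in _ + X]mxE.
have stepF d : B *m d = 0 -> exists2 e, 0 < e & F (y0 + e *: d).
  move=> /B0 Bd.
  have [i|i yi|e e0 eP] := @small_step _ _ (fun i => (Z *m y0) i 0 - z i 0)
      (fun i => (Z *m d) i 0).
  - by rewrite subr_ge0; move: Py0; rewrite PE; apply.
  - by rewrite Bd //; lra.
  exists e => //; rewrite FE PE; split=> i.
    by rewrite Zstep; have := eP i; lra.
  by move=> yi; rewrite Zstep yi Bd // mulr0 addr0.
have dimF : affdim F = (q.+1 - \rank B)%N.
  rewrite -(mxrank_tr B) -mxrank_ker.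
  have kerE (d : V) : (d^T <= kermx B^T)%MS <-> B *m d = 0.
    split=> [/sub_kermxP|Bd]; last by apply/sub_kermxP; rewrite -trmx_mul Bd trmx0.
    by rewrite -trmx_mul => H; rewrite -[LHS]trmxK H trmx0.
  apply: (affdim_rank (a := y0)) => //.
    move=> y; rewrite FE => -[Py yF]; apply/kerE/B0 => i yi.
    by rewrite mulmxBr [LHS]mxE [X in _ + X]mxE yF // yi subrr.
  by move=> d /kerE; exact: stepF.
pose wb := unlift (Z^T *m u) (dotp z u).
(* the matrix of the map sending a direction [d] orthogonal to [p] to the
   direction of the lower image along which the value at [y0] is constant *)
pose L : 'M[R]_q.+1 :=
  \matrix_(i, j) (if j == ord_max then y0 i 0 else (i == j)%:R).
have LE (v : 'rV[R]_q.+1) : v *m L = (unlift v^T (dotp v^T y0))^T.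
  apply/matrixP => i j; rewrite (ord1 i) [RHS]mxE [LHS]mxE.
  have [->|jm] := eqVneq j ord_max.
    by rewrite unlift_max dotpE; apply: eq_bigr => l _; rewrite !mxE eqxx.
  rewrite unlift_neq // (bigD1 j) //= !mxE (negbTE jm) eqxx mulr1.
  rewrite big1 ?addr0 // => l /negbTE lj; by rewrite !mxE (negbTE jm) lj mulr0.
pose M := ((B :&: kermx p)%MS *m L).
(* combinations of active constraints vanish on F *)
have zeroF (u' : 'cV[R]_r) y : F y -> dotp p (Z^T *m u') = 1 ->
    (forall i, (Z *m y0) i 0 <> z i 0 -> u' i 0 = 0) ->
    phi y (unlift (Z^T *m u') (dotp z u')) = 0.
  rewrite FE => -[_ yF] pu' u'0; rewrite phi_comb // big1 // => i _.
  have [/yF ->|/u'0 ->] := pselect ((Z *m y0) i 0 = z i 0).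
    by rewrite subrr mulr0.
  by rewrite mul0r.
have Fswb : Psi_inv F wb.
  by rewrite FsE; split=> [|y Fy]; [exact: lower_comb|exact: zeroF].
have FsM w : Psi_inv F w -> ((w - wb)^T <= M)%MS.
  move: Fswb; rewrite FsE => -[_ wbF] [_ wF].
  pose dl := lift c w - lift c wb.
  have -> : (w - wb)^T = dl^T *m L.
    rewrite LE trmxK; congr (_^T); apply/matrixP => i j; rewrite (ord1 j).
    have -> : (w - wb) i 0 = w i 0 - wb i 0 by rewrite [LHS]mxE [X in _ + X]mxE.
    have [->|im] := eqVneq i ord_max; last first.
      rewrite [RHS]unlift_neq // /dl -(@lift_neq _ _ c w i im).
      by rewrite -(@lift_neq _ _ c wb i im) [RHS]mxE [X in _ = _ + X]mxE.
    rewrite [RHS]unlift_max dotpDl dotpNl.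
    have := wF _ Fy0; have := wbF _ Fy0; rewrite !phiE.
    by move=> /subr0_eq -> /subr0_eq ->.
  rewrite submxMr // sub_capmx; apply/andP; split; last first.
    apply/sub_kermxP/matrixP => i j; rewrite (ord1 i) (ord1 j).
    by rewrite -/(dotp dl p) mxE dotpDl dotpNl !(dotpC _ p) !dotp_lift // subrr.
  have dl0 (d : V) : B *m d = 0 -> dotp dl d = 0.
    move=> /stepF[e e0 Fe].
    have ld v : (forall y, F y -> phi y v = 0) -> dotp (lift c v) d = 0.
      move=> vF; have := vF _ Fe; have := vF _ Fy0; rewrite !phiE dotpDr dotpZr.
      move=> v0 v1; have /eqP : e * dotp (lift c v) d = 0 by lra.
      by rewrite mulf_eq0 gt_eqF //= => /eqP.
    by rewrite dotpDl dotpNl !ld // subrr.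
  (* a vector orthogonal to the kernel of B lies in its row space *)
  rewrite submxE; apply/eqP/matrixP => i j; rewrite (ord1 i).
  have Bk : B *m col j (cokermx B) = 0.
    by rewrite colE mulmxA mulmx_coker mul0mx.
  by have := dl0 _ Bk; rewrite /dotp colE mulmxA -colE [LHS]mxE => ->; rewrite mxE.
have MFs (d : V) : (d^T <= M)%MS -> exists2 e, 0 < e & Psi_inv F (wb + e *: d).
  move=> /submxP[X dX]; pose v := X *m (B :&: kermx p)%MS.
  have : (v <= B :&: kermx p)%MS by exact: submxMl.
  rewrite sub_capmx => /andP[/submxP[mu vmu] /sub_kermxP vp].
  pose nu : 'cV[R]_r := \col_i (if (Z *m y0) i 0 == z i 0 then mu 0 i else 0).
  have nu0 i : (Z *m y0) i 0 <> z i 0 -> nu i 0 = 0.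
    by move=> /eqP/negbTE yi; rewrite [LHS]mxE yi.
  have Znu : Z^T *m nu = v^T.
    apply/matrixP => i j; rewrite (ord1 j) vmu [LHS]mxE [RHS]mxE [RHS]mxE.
    apply: eq_bigr => l _; rewrite [nu _ _]mxE [B _ _]mxE [Z^T _ _]mxE.
    by case: ifP; rewrite ?mulr0 // mulrC.
  have znu : dotp z nu = dotp v^T y0.
    rewrite -Znu dotp_trmul dotpC !dotpE; apply: eq_bigr => i _.
    by have [->|/nu0 ->] := pselect ((Z *m y0) i 0 = z i 0); rewrite ?mul0r.
  have [i|i|e e0 eP] := @small_step _ _ (fun i => u i 0) (fun i => nu i 0).
  - exact: unneg.
  - move=> ui; have [/upos|/nu0 -> //] := pselect ((Z *m y0) i 0 = z i 0).
    by rewrite ui ltxx.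
  (* perturbing the weights of the active constraints moves wb along d *)
  exists e => //; pose u' := u + e *: nu.
  have u'E i : u' i 0 = u i 0 + e * nu i 0 by rewrite [LHS]mxE [X in _ + X]mxE.
  have Zu' : Z^T *m u' = Z^T *m u + e *: v^T.
    by rewrite mulmxDr -scalemxAr Znu.
  have pu' : dotp p (Z^T *m u') = 1.
    rewrite Zu' dotpDr dotpZr pu dotpC.
    by rewrite /dotp trmxK vp mxE mulr0 addr0.
  have -> : wb + e *: d = unlift (Z^T *m u') (dotp z u').
    have -> : d = unlift v^T (dotp v^T y0).
      by rewrite -[LHS]trmxK dX mulmxA LE trmxK.
    rewrite Zu' dotpDr dotpZr znu; apply/matrixP => i j; rewrite (ord1 j).
    rewrite [LHS]mxE [X in _ + X]mxE.
    have [->|im] := eqVneq i ord_max; first by rewrite !unlift_max.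
    by rewrite !unlift_neq // [RHS]mxE [X in _ = _ + X]mxE.
  rewrite FsE; split.
    by apply: lower_comb => // i; rewrite u'E.
  move=> y Fy; apply: zeroF => // i yi.
  by rewrite u'E u0 // nu0 // mulr0 addr0.
have dimFs : affdim (Psi_inv F) = \rank M by exact: (affdim_rank Fswb).
have rankBp : \rank (B *m p) = 1%N.
  apply/eqP; rewrite eqn_leq rank_leq_col lt0n mxrank_eq0; apply/eqP => /B0 Bp.
  have /eqP : dotp p (Z^T *m u) = 0.
    rewrite dotpC dotp_trmul dotpE; apply: big1 => i _.
    have [/Bp ->|/u0 ->] := pselect ((Z *m y0) i 0 = z i 0); first exact: mulr0.
    exact: mul0r.
  by rewrite pu oner_eq0.
have capL : ((B :&: kermx p) :&: kermx L)%MS = 0.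
  apply/eqP/rowV0P => v; rewrite !sub_capmx => /andP[/andP[_ /sub_kermxP vp]].
  move=> /sub_kermxP; rewrite LE => H.
  have vneq i : i != ord_max -> v 0 i = 0.
    move=> im; have /matrixP/(_ 0 i) := H.
    by rewrite mxE unlift_neq // [v^T _ _]mxE => ->; rewrite mxE.
  have /matrixP/(_ 0 0) := vp.
  rewrite [LHS]mxE (bigD1 ord_max) //= p_max mulr1 big1 => [|i im]; last first.
    by rewrite vneq // mul0r.
  rewrite addr0 [RHS]mxE => vmax; apply/matrixP => i j; rewrite (ord1 i) [RHS]mxE.
  by have [->|/vneq] := eqVneq j ord_max.
have := mxrank_mul_ker (B :&: kermx p)%MS L; have := mxrank_mul_ker B p.
rewrite rankBp capL mxrank0 addn0 dimFs dimF -/M => rB ->.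
have := rank_leq_col B; rewrite -rB add1n ltnS => rq.
by rewrite subSS subnKC.
Qed.

End Images.

Theorem theorem2p3 (R : realType) (n m q : nat)
    (A : 'M[R]_(m.+1, n.+1)) (P : 'M[R]_(q.+1, n.+1)) (b : 'cV[R]_m.+1)
    (C : set 'cV[R]_q.+1) (c : 'cV[R]_(q.+1 + 1))
    (C_polycone : polyhedral_convex_cone C)
    (C_pointed : pointed_cone C)
    (C_nontrivial : C <> [set 0])
    (S_nonempty : feasible A b !=set0)
    (c_ri : relint C (pvec c))
    (c_last : dsubmx c = 0)
    (c_q : pvec c ord_max 0 = 1) :
  let Dimg := lower_image A P b C c in
  let Pimg := upper_image A P b C in
  let Dfaces := maximal_proper_faces (@Rstar R q) Dimg in
  let Pfaces := minimal_proper_faces (ray (pvec c)) Pimg in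
  let Psi := Psi A P b C c in
  let Psi_inv := Psi_inv A P b C c in
  [/\ set_bij Dfaces Pfaces Psi,
      forall F1 F2, Dfaces F1 -> Dfaces F2 ->
        (F1 `<=` F2 <-> Psi F2 `<=` Psi F1),
      {in Dfaces, cancel Psi Psi_inv} /\ {in Pfaces, cancel Psi_inv Psi} &
      forall Fs, Dfaces Fs -> (affdim Fs + affdim (Psi Fs))%N = q.+1.-1].
Proof.
move=> Dimg Pimg Dfaces Pfaces PsiF PsiI.
have Cp : C (pvec c) by case: c_ri.
have PsiD : forall F, Dfaces F -> Pfaces (PsiF F).
  by move=> F; exact: (Psi_Dfaces C_polycone S_nonempty Cp c_q).
have PsiIP : forall F, Pfaces F -> Dfaces (PsiI F).
  by move=> F; exact: (Psi_inv_Pfaces C_polycone S_nonempty Cp c_q).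
have PsiFK : forall F, Dfaces F -> PsiI (PsiF F) = F.
  by move=> F; exact: (PsiK C_polycone S_nonempty c_q).
have PsiIK : forall F, Pfaces F -> PsiF (PsiI F) = F.
  by move=> F; exact: (Psi_invK C_polycone S_nonempty Cp c_q).
split.
- split=> //.
  + by move=> F1 F2 /set_mem F1D /set_mem F2D /(congr1 PsiI); rewrite !PsiFK.
  + by move=> F FP; exists (PsiI F); [exact: PsiIP|exact: PsiIK].
- move=> F1 F2 F1D F2D; split=> [F12 y yP w F1w|P21]; first exact/yP/F12.
  by rewrite -(PsiFK F1) // -(PsiFK F2) // => w wP y Fy; exact/wP/P21.
- by split=> F /set_mem; [exact: PsiFK|exact: PsiIK].
- move=> F FD; rewrite -{1}(PsiFK F FD).
  exact: (affdim_Psi_inv C_polycone S_nonempty Cp c_q (PsiD F FD)).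
Qed.
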